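(* Let $A=k_{\mathfrak M}\langle x_1,\ldots,x_n\rangle$ be the free algebra of a variety $\mathfrak M$ of $m$-ary algebras over a field $k$, freely generated by $x_1,\ldots,x_n$. Let $D$ be an arbitrary element of $\mathscr{L}(A)$. If the Jacobian matrix $J(D)$ of $D$ is nilpotent, then the right multiplication operator $R_D$ is a nilpotent element of the multiplication algebra $M(\mathscr{L}(A))$.
   Context: Let $m\ge 2$. An $m$-ary algebra over $k$ is a $k$-vector space with one $m$-ary multilinear operation $\langle\cdot,\ldots,\cdot\rangle$; a derivation is a $k$-linear map satisfying the Leibniz rule for this operation. If $m=2$ and $\mathfrak M$ is a unitary variety (a variety of algebras with identity element), $A$ is assumed to contain an identity element $1$. Convention: varieties are nontrivial and such that free algebras are graded by degrees in the free generators and every map from the free generators to the free algebra extends uniquely to a derivation (automatic if $k$ is infinite). For a column $F=(f_1,\ldots,f_n)'$ of elements of $A$, $D_F=f_1\partial_1+\cdots+f_n\partial_n$ denotes the unique derivation of $A$ with $D_F(x_i)=f_i$ for all $i$; in particular $a\partial_i$ is the derivation with $x_i\mapsto a$ and $x_j\mapsto 0$ for $j\ne i$. Every derivation of $A$ has a unique expression of this form. $\mathscr{L}(A)$ denotes the space $\mathrm{Der}_kA$ of all $k$-linear derivations of $A$ with the bilinear product determined by $(a\partial_i)\cdot(b\partial_j)=((a\partial_i)(b))\partial_j$ for $a,b\in A$. $R_D:\mathscr{L}(A)\to\mathscr{L}(A)$ is $u\mapsto u\cdot D$. For an $m$-ary algebra $B$, $b_1,\ldots,b_{m-1}\in B$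 and $1\le i\le m$, let $M_i(b_1,\ldots,b_{m-1}):B\to B$ be $x\mapsto\langle b_1,\ldots,b_{i-1},x,b_i,\ldots,b_{m-1}\rangle$. The multiplication algebra $M(B)$ is the associative algebra with identity generated by all these operators (for binary algebras such as $\mathscr{L}(A)$: by all left and right multiplications). Let $C=k_{\mathfrak M}\langle x_1,\ldots,x_n,y_1,\ldots,y_n\rangle$ be the free algebra in $2n$ variables, $\Omega_A\subset C$ the subspace of elements homogeneous of degree $1$ in $y_1,\ldots,y_n$, and $\Omega:C\to C$ the derivation with $x_i\mapsto y_i$, $y_i\mapsto 0$; then $\Omega(A)\subseteq\Omega_A$. For $b_1,\ldots,b_{m-1}\in A$ let $U_i(b_1,\ldots,b_{m-1}):\Omega_A\to\Omega_A$ be the restriction of $M_i(b_1,\ldots,b_{m-1})\in M(C)$. The universal enveloping algebra $A^e$ is the associative algebra with identity generated by all $U_i(b_1,\ldots,b_{m-1})$. $\Omega_A$ is a free left $A^e$-module with basis $y_1,\ldots,y_n$, and for $b\in A$ the Fox derivatives $\frac{\partial b}{\partial x_i}\in A^e$ are defined by $\Omega(b)=\sum_i \frac{\partial b}{\partial x_i}y_i$. The Jacobian matrix of $D=D_F$, $F=(f_1,\ldots,f_n)'$, is the $n\times n$ matrix $J(D)=J(F)=\left(\frac{\partial f_i}{\partial x_j}\right)_{1\le i,j\le n}$ over $A^e$. *)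

(* Defs.v *)
From HB Require Import structures.
From mathcomp Require Import all_boot all_order all_algebra.
From mathcomp Require Import boolp classical_sets functions.

Set Implicit Arguments.
Unset Strict Implicit.
Unset Printing Implicit Defensive.
Import GRing.Theory.
Local Open Scope ring_scope.
Local Open Scope classical_set_scope.

Definition nilpotent (R : pzRingType) (x : R) : Prop := exists N : nat, x ^+ N = 0.

Section Span.
Context (k : fieldType) (W : lmodType k).

Inductive span (S : set W) : W -> Prop :=
| span0 : span S 0
| spanD c s w : S s -> span S w -> span S (c *: s + w).

Lemma span_ind_lin (S P : set W) :
  P 0 -> (forall c x y, P x -> P y -> P (c *: x + y)) -> S `<=` P -> span S `<=` P.
Proof. by move=> P0 Pl SP w; elim=> // c s {}w /SP Ps _; apply: Pl. Qed.

Lemma span_lin (S : set W) c x y : span S x -> span S y -> span S (c *: x + y).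
Proof.
move=> Sx Sy; elim: Sx => [|d s w Ss _ IH]; first by rewrite scaler0 add0r.
by rewrite scalerDr scalerA -addrA; constructor.
Qed.

Lemma span_sub (S : set W) : S `<=` span S.
Proof. by move=> s Ss; rewrite -[s]addr0 -[s]scale1r; do 2?constructor. Qed.
End Span.

Section OperatorAlgebra.
Context (k : fieldType) (W : lmodType k) (G : set {linear W -> W}).

Inductive generated : (W -> W) -> Prop :=
| gen_in g : G g -> generated g
| gen_id : generated idfun
| gen_lin c f g : generated f -> generated g -> generated (c *: f + g)
| gen_comp f g : generated f -> generated g -> generated (f \o g).

Definition opgen : {pred W -> W} := [pred f | `[< generated f >]].

Lemma opgenP f : reflect (generated f) (f \in opgen).
Proof. exact: asboolP. Qed.

Lemma generated0 : generated 0.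
Proof.
have := gen_lin (-1) gen_id gen_id.
by rewrite scaleN1r addNr.
Qed.

Lemma opgen_submod : submod_closed opgen.
Proof.
split=> [|c f g]; first exact/opgenP/generated0.
by move=> /opgenP hf /opgenP hg; apply/opgenP/gen_lin.
Qed.
HB.instance Definition _ := GRing.isSubmodClosed.Build k (W -> W) opgen opgen_submod.

(* Its product is composition: (f * g) w = f (g w). *)
Record opalg := OpAlg { op_fun :> W -> W; op_funP : op_fun \in opgen }.
HB.instance Definition _ := [isSub for op_fun].
HB.instance Definition _ := [Choice of opalg by <:].
HB.instance Definition _ := [SubChoice_isSubLmodule of opalg by <:].

Lemma generated_linear f : generated f -> linear f.
Proof.
elim=> [g _|//|c f1 g _ hf _ hg|f1 g _ hf _ hg] a x y.
- exact: linearP.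
- rewrite !addrfctE !scalrfctE hf hg !scalerDr !scalerA [c * a]mulrC -!addrA.
  by congr (_ + _); rewrite addrCA.
- by rewrite /= hg hf.
Qed.

Lemma op_linear (f : opalg) : linear f.
Proof. exact/generated_linear/opgenP/op_funP. Qed.
HB.instance Definition _ (f : opalg) :=
  GRing.isLinear.Build k W W *:%R (op_fun f) (op_linear f).

Lemma op_one_subproof : idfun \in opgen.
Proof. exact/opgenP/gen_id. Qed.
Definition op_one := OpAlg op_one_subproof.

Lemma op_mul_subproof (f g : opalg) : op_fun f \o op_fun g \in opgen.
Proof. by apply/opgenP/gen_comp; apply/opgenP/op_funP. Qed.
Definition op_mul (f g : opalg) := OpAlg (op_mul_subproof f g).

Lemma opalg_eq (f g : opalg) : f =1 g -> f = g.
Proof. by move=> fg; apply/val_inj/funext. Qed.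

Lemma op_mulA : associative op_mul.
Proof. by move=> f g h; apply: opalg_eq. Qed.
Lemma op_mul1l : left_id op_one op_mul.
Proof. by move=> f; apply: opalg_eq. Qed.
Lemma op_mul1r : right_id op_one op_mul.
Proof. by move=> f; apply: opalg_eq. Qed.
Lemma op_mulDl : left_distributive op_mul +%R.
Proof. by move=> f g h; apply: opalg_eq. Qed.
Lemma op_mulDr : right_distributive op_mul +%R.
Proof. by move=> f g h; apply: opalg_eq => x; rewrite /= linearD. Qed.
HB.instance Definition _ :=
  GRing.Zmodule_isPzRing.Build opalg op_mulA op_mul1l op_mul1r op_mulDl op_mulDr.

Lemma op_mem_subproof (g : {linear W -> W}) : G g -> (g : W -> W) \in opgen.
Proof. by move=> Gg; apply/opgenP/gen_in. Qed.
Definition op_gen g (Gg : G g) : opalg := OpAlg (op_mem_subproof Gg).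

Lemma op0E (w : W) : (0 : opalg) w = 0. Proof. by []. Qed.
Lemma op1E (w : W) : (1 : opalg) w = w. Proof. by []. Qed.
Lemma opDE (f g : opalg) w : (f + g) w = f w + g w. Proof. by []. Qed.
Lemma opNE (f : opalg) w : (- f) w = - f w. Proof. by []. Qed.
Lemma opZE c (f : opalg) w : (c *: f) w = c *: f w. Proof. by []. Qed.
Lemma opME (f g : opalg) w : (f * g) w = f (g w). Proof. by []. Qed.
Lemma op_sumE I (r : seq I) (P : pred I) (F : I -> opalg) w :
  (\sum_(i <- r | P i) F i) w = \sum_(i <- r | P i) F i w.
Proof. by elim/big_rec2: _ => // i y f _ <-. Qed.

End OperatorAlgebra.

Definition multilinear (k : fieldType) (V : lmodType k) m (op : ('I_m -> V) -> V) :=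
  forall (a : 'I_m -> V) (i : 'I_m), linear (fun x => op [eta a with i |-> x]).

(* [u] tells whether an identity element belongs to the signature; only the
   case m = 2 is used when it does (see [variety]). *)
Record malgebra (k : fieldType) (m : nat) (u : bool) := MAlgebra {
  carrier :> lmodType k;
  mop : ('I_m -> carrier) -> carrier;
  mone : u -> carrier;
  mop_multilinear : multilinear mop;
  mone_id : forall (hu : u) (i : 'I_m) (x : carrier),
    mop [eta (fun=> mone hu) with i |-> x] = x
}.
Arguments mop {k m u} _ _.
Arguments mone {k m u} _ _.

(* b_1, .., b_(i-1), x, b_i, .., b_(m-1) *)
Definition insert T m (i : 'I_m) (b : 'I_m.-1 -> T) (x : T) : 'I_m -> T :=
  fun j => if unlift i j is Some j' then b j' else x.

Section MAlgebraTheory.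
Context (k : fieldType) (m : nat) (u : bool).
Implicit Types A B : malgebra k m u.

Definition is_hom A B (f : A -> B) : Prop :=
  [/\ linear f, forall a, f (mop A a) = mop B (f \o a)
    & forall hu, f (mone A hu) = mone B hu].

Definition is_derivation A (D : A -> A) : Prop :=
  linear D /\
  forall a : 'I_m -> A, D (mop A a) = \sum_i mop A [eta a with i |-> D (a i)].

Definition derivation A : {pred A -> A} := [pred D | `[< is_derivation D >]].
Arguments derivation : clear implicits.

Lemma derivationP A (D : A -> A) : reflect (is_derivation D) (D \in derivation A).
Proof. exact: asboolP. Qed.

Lemma mop_lin A (a : 'I_m -> A) i c x y :
  mop A [eta a with i |-> c *: x + y] =
  c *: mop A [eta a with i |-> x] + mop A [eta a with i |-> y].
Proof. exact: (mop_multilinear a i). Qed.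

Lemma mop_upd0 A (a : 'I_m -> A) i : mop A [eta a with i |-> 0] = 0.
Proof.
by have := mop_lin a i (-1) 0 0; rewrite scaler0 addr0 scaleN1r addNr.
Qed.

Lemma derivation_submod A : submod_closed (derivation A).
Proof.
split=> [|c f g /derivationP[fl fd] /derivationP[gl gd]]; apply/derivationP; split.
- by move=> c x y; rewrite /= scaler0 addr0.
- by move=> a; rewrite big1 // => i _; apply: mop_upd0.
- move=> d x y; rewrite !addrfctE !scalrfctE fl gl !scalerDr !scalerA [d * c]mulrC.
  by rewrite -!addrA; congr (_ + _); rewrite addrCA.
- move=> a; rewrite !addrfctE !scalrfctE fd gd scaler_sumr -big_split /=.
  by apply: eq_bigr => i _; rewrite mop_lin.
Qed.
HB.instance Definition _ A :=
  GRing.isSubmodClosed.Build k (A -> A) (derivation A) (derivation_submod A).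

Record Der A := MkDer { der_fun :> A -> A; der_funP : der_fun \in derivation A }.
HB.instance Definition _ A := [isSub for @der_fun A].
HB.instance Definition _ A := [Choice of Der A by <:].
HB.instance Definition _ A := [SubChoice_isSubLmodule of Der A by <:].

Lemma der_linear A (D : Der A) : linear D.
Proof. by have /derivationP[] := der_funP D. Qed.
HB.instance Definition _ A (D : Der A) :=
  GRing.isLinear.Build k A A *:%R (der_fun D) (der_linear D).

Lemma der_mop A (D : Der A) (a : 'I_m -> A) :
  D (mop A a) = \sum_i mop A [eta a with i |-> D (a i)].
Proof. by have /derivationP[] := der_funP D. Qed.

Lemma der_eq A (D E : Der A) : D =1 E -> D = E.
Proof. by move=> h; apply/val_inj/funext. Qed.

Definition mulop A (i : 'I_m) (b : 'I_m.-1 -> A) (x : A) : A := mop A (insert i b x).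

Lemma insertE A (i : 'I_m) (b : 'I_m.-1 -> A) x :
  insert i b x = [eta insert i b 0 with i |-> x].
Proof.
apply/funext => j /=; rewrite /insert; case: eqP => [->|/eqP ji].
  by rewrite unlift_none.
by case: unliftP ji => [j' ->|->]; rewrite ?eqxx.
Qed.

Lemma insert_lift A (a : 'I_m -> A) (i : 'I_m) x :
  insert i (a \o lift i) x = [eta a with i |-> x].
Proof.
apply/funext => j /=; rewrite /insert; case: unliftP => [j' ->|->] /=.
  by rewrite eq_sym (negPf (neq_lift _ _)).
by rewrite eqxx.
Qed.

Lemma insert_id A (a : 'I_m -> A) (i : 'I_m) : insert i (a \o lift i) (a i) = a.
Proof. by rewrite insert_lift; apply/funext => j /=; case: eqP => [->|]. Qed.

Lemma mulop_linear A (i : 'I_m) (b : 'I_m.-1 -> A) : linear (mulop i b).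
Proof.
by move=> c x y; rewrite /mulop insertE mop_lin -!insertE.
Qed.
HB.instance Definition _ A i b :=
  GRing.isLinear.Build k A A *:%R (mulop i b) (@mulop_linear A i b).

Definition multops A : set {linear A -> A} :=
  [set g | exists i (b : 'I_m.-1 -> A), g = mulop i b].
Definition multalg A := opalg (@multops A).

(* Values of the nonassociative monomials in the free generators under x |-> g x,
   together with their degrees in each of the generators. *)
Inductive monomial (X : finType) A (g : X -> A) : (X -> nat) -> A -> Prop :=
| mono_gen x : monomial g (fun y => (y == x : nat)) (g x)
| mono_one (hu : u) : monomial g (fun=> 0%N) (mone A hu)
| mono_op (d : 'I_m -> X -> nat) (a : 'I_m -> A) :
    (forall i, monomial g (d i) (a i)) ->
    monomial g (fun x => (\sum_i d i x)%N) (mop A a).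

Definition homogeneous (X : finType) A (g : X -> A) (d : X -> nat) : set A :=
  span (monomial g d).

End MAlgebraTheory.

(* Expressions denoting nonassociative polynomials; they are not normalised, only
   their values in algebras are ever compared. *)
Inductive npoly (k : fieldType) (m : nat) (u : bool) (X : Type) : Type :=
| NVar of X
| NZero
| NOne of u
| NAdd of npoly k m u X & npoly k m u X
| NScale of k & npoly k m u X
| NOp of 'I_m -> npoly k m u X.
Arguments NZero {k m u X}.

Fixpoint neval k m u X (A : malgebra k m u) (v : X -> A) (t : npoly k m u X) : A :=
  match t with
  | NVar x => v x
  | NZero => 0
  | NOne hu => mone A hu
  | NAdd t1 t2 => neval v t1 + neval v t2
  | NScale c t1 => c *: neval v t1
  | NOp f => mop A (fun i => neval v (f i))
  end.

(* A class of m-ary algebras defined by identities; the algebras have an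
   identity element, which may occur in the identities, when [unitary] holds. *)
Record equational_class (k : fieldType) (m : nat) := EquationalClass {
  unitary : bool;
  identities : set (npoly k m unitary nat)
}.

Definition in_class k m (V : equational_class k m) (B : malgebra k m (unitary V)) :=
  forall t, identities t -> forall v : nat -> B, neval v t = 0.

(* Nonassociative polynomials in X modulo the identities that hold in all algebras
   of the class. The result is freely generated by X in the class, see
   [free_in_class], [lift_is_hom], [lift_gen] and [free_hom_eq]. *)
Section Free.
Context (k : fieldType) (m : nat) (V : equational_class k m) (X : Type).
Let u := unitary V.
Notation poly := (npoly k m u X).
Implicit Types (s t : poly) (B : malgebra k m u).

Definition nequiv s t : Prop :=
  forall B, in_class B -> forall v : X -> B, neval v s = neval v t.

HB.instance Definition _ := gen_eqMixin poly.
HB.instance Definition _ := gen_choiceMixin poly.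

Definition nequivb : rel poly := fun s t => `[< nequiv s t >].

Lemma nequivb_equiv : equiv_class_of nequivb.
Proof.
split=> [t|s t|t s r].
- exact/asboolP.
- by apply/asboolP/asboolP => h B hB v; rewrite h.
- by move=> /asboolP h1 /asboolP h2; apply/asboolP => B hB v; rewrite h1 ?h2.
Qed.
Canonical nequiv_rel := EquivRelPack nequivb_equiv.

Definition free_carrier : Type := {eq_quot nequiv_rel}%qT.
HB.instance Definition _ := Choice.on free_carrier.
Definition npi (t : poly) : free_carrier := \pi_({eq_quot nequiv_rel})%qT t.
Definition nrepr (a : free_carrier) : poly := repr a.

Lemma nreprK a : npi (nrepr a) = a. Proof. exact: reprK. Qed.
Lemma npiP s t : npi s = npi t <-> nequiv s t.
Proof.
split; first by move=> /eqP; rewrite /npi piE => /asboolP.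
by move=> h; apply/eqP; rewrite /npi piE; apply/asboolP.
Qed.
Lemma npiK t : nequiv (nrepr (npi t)) t.
Proof. by apply/npiP; rewrite nreprK. Qed.

Definition free_zero := npi NZero.
Definition free_add a b := npi (NAdd (nrepr a) (nrepr b)).
Definition free_scale c a := npi (NScale c (nrepr a)).
Definition free_opp a := free_scale (-1) a.
Definition free_mop (a : 'I_m -> free_carrier) := npi (NOp (nrepr \o a)).
Definition free_mone (hu : u) := npi (NOne _ _ _ hu).

Definition feval B (v : X -> B) (a : free_carrier) : B := neval v (nrepr a).

Lemma feval_pi B (hB : in_class B) (v : X -> B) t : feval v (npi t) = neval v t.
Proof. exact: npiK. Qed.

Lemma feval_inj a b :
  (forall B, in_class B -> forall v : X -> B, feval v a = feval v b) -> a = b.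
Proof. by move=> h; rewrite -(nreprK a) -(nreprK b); apply/npiP => B hB v; exact: h. Qed.

Lemma free_addA : associative free_add.
Proof.
move=> a b c; apply: feval_inj => B hB v.
by rewrite !(feval_pi hB) /= -!/(feval _ _) !(feval_pi hB) /= addrA.
Qed.
Lemma free_addC : commutative free_add.
Proof. by move=> a b; apply: feval_inj => B hB v; rewrite !(feval_pi hB) /= addrC. Qed.
Lemma free_add0 : left_id free_zero free_add.
Proof.
move=> a; apply: feval_inj => B hB v.
by rewrite !(feval_pi hB) /= -!/(feval _ _) !(feval_pi hB) /= add0r.
Qed.
Lemma free_addN : left_inverse free_zero free_opp free_add.
Proof.
move=> a; apply: feval_inj => B hB v.
by rewrite !(feval_pi hB) /= -!/(feval _ _) !(feval_pi hB) /= scaleN1r addNr.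
Qed.
HB.instance Definition _ :=
  GRing.isZmodule.Build free_carrier free_addA free_addC free_add0 free_addN.

Lemma free_scaleA c d a : free_scale c (free_scale d a) = free_scale (c * d) a.
Proof.
apply: feval_inj => B hB v.
by rewrite !(feval_pi hB) /= -!/(feval _ _) !(feval_pi hB) /= scalerA.
Qed.
Lemma free_scale1 : left_id 1 free_scale.
Proof. by move=> a; apply: feval_inj => B hB v; rewrite !(feval_pi hB) /= scale1r. Qed.
Lemma free_scaleDr : right_distributive free_scale +%R.
Proof.
move=> c a b; apply: feval_inj => B hB v.
by rewrite !(feval_pi hB) /= -!/(feval _ _) !(feval_pi hB) /= scalerDr.
Qed.
Lemma free_scaleDl a : {morph free_scale^~ a : c d / c + d}.
Proof.
move=> c d; apply: feval_inj => B hB v.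
by rewrite !(feval_pi hB) /= -!/(feval _ _) !(feval_pi hB) /= scalerDl.
Qed.
HB.instance Definition _ := GRing.Zmodule_isLmodule.Build k free_carrier
  free_scaleA free_scale1 free_scaleDr free_scaleDl.

Lemma fevalD B (hB : in_class B) (v : X -> B) a b :
  feval v (a + b) = feval v a + feval v b.
Proof. by rewrite (feval_pi hB). Qed.
Lemma fevalZ B (hB : in_class B) (v : X -> B) c a :
  feval v (c *: a) = c *: feval v a.
Proof. by rewrite (feval_pi hB). Qed.
Lemma feval_mop B (hB : in_class B) (v : X -> B) a :
  feval v (free_mop a) = mop B (feval v \o a).
Proof. by rewrite (feval_pi hB). Qed.

Lemma free_multilinear : multilinear free_mop.
Proof.
move=> a i c x y; apply: feval_inj => B hB v.
rewrite fevalD // fevalZ // !feval_mop //.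
have E z : feval v \o [eta a with i |-> z] = [eta feval v \o a with i |-> feval v z].
  by apply/funext => j /=; case: eqP.
by rewrite !E fevalD // fevalZ // mop_lin.
Qed.

Lemma free_mone_id (hu : u) (i : 'I_m) x :
  free_mop [eta (fun=> free_mone hu) with i |-> x] = x.
Proof.
apply: feval_inj => B hB v; rewrite feval_mop //.
rewrite -[RHS](mone_id hu i); congr (mop B _); apply/funext => j /=.
by case: eqP => // _; rewrite (feval_pi hB).
Qed.

Definition free : malgebra k m u := MAlgebra free_multilinear free_mone_id.

Definition gen (x : X) : free := npi (NVar k m u x).

Definition lift_hom B (v : X -> B) : free -> B := feval v.

Lemma lift_gen B (hB : in_class B) (v : X -> B) x : lift_hom v (gen x) = v x.
Proof. exact: (feval_pi hB). Qed.

Lemma lift_is_hom B (hB : in_class B) (v : X -> B) : is_hom (lift_hom v).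
Proof.
split=> [c a b|a|hu]; last exact: (feval_pi hB).
- by rewrite /lift_hom fevalD // fevalZ.
- exact: feval_mop.
Qed.

Lemma npi_eval (t : poly) : npi t = neval gen t :> free.
Proof.
elim: t => [x||hu|s hs t ht|c t ht|f hf] //=; rewrite -?hs -?ht.
- apply: feval_inj => B hB v; rewrite (fevalD hB) !(feval_pi hB).
  by [].
- by apply: feval_inj => B hB v; rewrite (fevalZ hB) !(feval_pi hB).
- apply: feval_inj => B hB v; rewrite (feval_mop hB) (feval_pi hB) /=.
  congr (mop B _); apply/funext => i /=; rewrite -hf.
  by rewrite (feval_pi hB).
Qed.

Lemma hom_neval (A B : malgebra k m u) (Y : Type) (f : A -> B) (v : Y -> A)
    (t : npoly k m u Y) : is_hom f -> f (neval v t) = neval (f \o v) t.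
Proof.
case=> fl fm f1.
pose fL : {linear A -> B} := HB.pack f (GRing.isLinear.Build _ _ _ _ f fl).
have fD x y : f (x + y) = f x + f y by exact: (raddfD fL).
have fZ c x : f (c *: x) = c *: f x by exact: (linearZZ fL).
elim: t => [x||hu|s hs t ht|c t ht|g hg] //=.
- exact: (raddf0 fL).
- by rewrite -hs -ht fD.
- by rewrite -ht fZ.
- by rewrite fm; congr (mop B _); apply/funext => i; rewrite /= hg.
Qed.

Lemma free_hom_eq B (f g : free -> B) :
  is_hom f -> is_hom g -> (forall x, f (gen x) = g (gen x)) -> f =1 g.
Proof.
move=> hf hg fg a; rewrite -(nreprK a) npi_eval !hom_neval //.
by congr (neval _ _); apply/funext.
Qed.


Lemma free_in_class : in_class free.
Proof.
move=> t ht v; apply: feval_inj => B hB w.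
have hl := lift_is_hom hB w.
transitivity (neval (lift_hom w \o v) t); first exact: (hom_neval _ _ hl).
by rewrite hB // (feval_pi hB).
Qed.

End Free.
(* The homogeneous components form a direct sum; that they span the free algebra
   is automatic. *)
Definition graded_by_degrees k m (V : equational_class k m) (X : finType) : Prop :=
  forall (s : seq {ffun X -> nat}) (a : {ffun X -> nat} -> free V X),
    uniq s -> (forall d : {ffun X -> nat}, homogeneous (@gen k m V X) d (a d)) ->
    \sum_(d <- s) a d = 0 -> forall d, d \in s -> a d = 0.

Definition derivations_extend k m (V : equational_class k m) (X : finType) : Prop :=
  forall f : X -> free V X,
    exists! D : Der (free V X), forall x, D (gen V x) = f x.

Record variety (k : fieldType) (m : nat) := Variety {
  var_class :> equational_class k m;
  var_unitary : unitary var_class -> m = 2%N;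
  var_nontrivial : exists B : malgebra k m (unitary var_class),
    in_class B /\ exists b : B, b <> 0;
  var_graded : forall X : finType, graded_by_degrees var_class X;
  var_derivations : forall X : finType, derivations_extend var_class X
}.

Section Derivations.
Context (k : fieldType) (m : nat) (V : variety k m).

Section DerOf.
Context (X : finType).
Implicit Types F G : X -> free V X.

Definition der_of F : Der (free V X) := sval (cid (var_derivations F)).

Lemma der_ofE F x : der_of F (gen V x) = F x.
Proof. by rewrite /der_of; case: cid => D [hD _] /=. Qed.

Lemma der_ext (D E : Der (free V X)) :
  (forall x, D (gen V x) = E (gen V x)) -> D = E.
Proof.
move=> h; have [D' [_ hu]] := var_derivations (fun x => E (gen V x)).
by rewrite -(hu D h) -(hu E).
Qed.

(* a ∂_x *)
Definition pder (a : free V X) (x : X) : Der (free V X) :=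
  der_of [eta (fun=> 0) with x |-> a].

Lemma pderE a x z : pder a x (gen V z) = if z == x then a else 0.
Proof. exact: der_ofE. Qed.

Lemma der_addE (D E : Der (free V X)) a : (D + E) a = D a + E a.
Proof. by []. Qed.
Lemma der_scaleE c (D : Der (free V X)) a : (c *: D) a = c *: D a.
Proof. by []. Qed.
Lemma der_sumE I (r : seq I) (P : pred I) (D : I -> Der (free V X)) a :
  (\sum_(i <- r | P i) D i) a = \sum_(i <- r | P i) D i a.
Proof. by elim/big_rec2: _ => // i y f _ <-. Qed.

Lemma sum_pderE (F : X -> free V X) z : (\sum_x pder (F x) x) (gen V z) = F z.
Proof.
rewrite der_sumE (bigD1 z) //= pderE eqxx big1 ?addr0 // => x xz.
by rewrite pderE eq_sym (negPf xz).
Qed.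

Lemma der_ofP F : der_of F = \sum_x pder (F x) x.
Proof. by apply: der_ext => x; rewrite sum_pderE der_ofE. Qed.

Lemma pder_lin x : linear (pder^~ x).
Proof.
move=> c a b; apply: der_ext => z.
by rewrite der_addE der_scaleE !pderE; case: eqP => //; rewrite scaler0 addr0.
Qed.
End DerOf.

Section LA.
Context (n : nat).
Let A := free V 'I_n.
Implicit Types u v D : Der A.

(* The bilinear product with (a ∂_i) . (b ∂_j) = ((a ∂_i)(b)) ∂_j, computed on
   u = sum_i u(x_i) ∂_i and v = sum_j v(x_j) ∂_j. *)
Definition dmul u v : Der A :=
  \sum_i \sum_j pder (pder (u (gen V i)) i (v (gen V j))) j.

Lemma der_decomp u : u = \sum_i pder (u (gen V i)) i.
Proof. by apply: der_ext => z; rewrite sum_pderE. Qed.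

Lemma dmulE u v z : dmul u v (gen V z) = u (v (gen V z)).
Proof.
rewrite /dmul der_sumE [in RHS](der_decomp u) der_sumE; apply: eq_bigr => i _.
by rewrite sum_pderE.
Qed.

Lemma dmul_pder (a b : A) (i j : 'I_n) :
  dmul (pder a i) (pder b j) = pder (pder a i b) j.
Proof.
apply: der_ext => z; rewrite dmulE !pderE; case: eqP => // _.
exact: linear0.
Qed.

Definition LA_op (w : 'I_2 -> Der A) : Der A := dmul (w ord0) (w ord_max).

Lemma LA_multilinear : multilinear LA_op.
Proof.
move=> w i c u v; apply: der_ext => z; rewrite /LA_op der_addE der_scaleE !dmulE /=.
case: i => [[|[|//]] /= hi]; rewrite /eq_op /= ?linearP //.
Qed.

Definition LA_one (h : false) : Der A := False_rect _ (notF h).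
Lemma LA_one_id (h : false) (i : 'I_2) (x : Der A) :
  LA_op [eta (fun=> LA_one h) with i |-> x] = x.
Proof. by []. Qed.

Definition LA : malgebra k 2 false := MAlgebra LA_multilinear LA_one_id.

Lemma Rmul_subproof D : (fun u : LA => dmul u D) \in opgen (@multops _ _ _ LA).
Proof.
apply/opgenP.
(* M_1 of a binary algebra is right multiplication *)
have -> : (fun u : LA => dmul u D) = mulop (A := LA) ord0 (fun=> D).
  by apply/funext => u; rewrite /mulop /= /LA_op /insert unlift_none; case: unliftP.
by apply: gen_in; exists ord0, (fun=> D).
Qed.

Definition Rmul D : multalg LA := OpAlg (Rmul_subproof D).

End LA.
End Derivations.

Section Fox.
Context (k : fieldType) (m : nat) (V : variety k m) (n : nat).
Let A := free V 'I_n.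
Let C := free V ('I_n + 'I_n)%type.

Definition xvar (i : 'I_n) : C := gen V (inl i).
Definition yvar (i : 'I_n) : C := gen V (inr i).

Definition iota : A -> C := lift_hom xvar.

Definition Omega : Der C := der_of (fun z : 'I_n + 'I_n =>
  match z with inl i => yvar i | inr _ => 0 end).

Definition ydeg (d : 'I_n + 'I_n -> nat) : nat := (\sum_i d (inr i))%N.

Definition ymonomial (e : nat) : set C :=
  [set w | exists2 d, monomial (@gen k m V ('I_n + 'I_n)%type) d w & ydeg d = e].

Lemma mop_span (S : 'I_m -> set C) (T : set C) :
  (forall a, (forall i, S i (a i)) -> T (mop C a)) ->
  forall a, (forall i, span (S i) (a i)) -> span T (mop C a).
Proof.
move=> ST a ha.
suff H (l : seq 'I_m) (b : 'I_m -> C) : (forall i, i \notin l -> S i (b i)) ->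
    (forall i, span (S i) (b i)) -> span T (mop C b).
  by apply: (H (enum 'I_m)) => // i; rewrite mem_enum.
elim: l b => [|i l IH] b hS hs.
  by apply/span_sub/ST => i; apply: hS.
have -> : b = [eta b with i |-> b i] by apply/funext => j /=; case: eqP => [->|].
move: (b i) (hs i); apply: span_ind_lin => [|c x y hx hy|s Ss].
- by rewrite mop_upd0; constructor.
- by rewrite mop_lin; apply: span_lin.
- apply: IH => j /=; case: eqP => [->//|/eqP ji]; last exact: hs.
    by move=> jl; apply: hS; rewrite inE negb_or ji.
  exact: span_sub.
Qed.


Lemma ymonomial_mop (e : 'I_m -> nat) a :
  (forall i, ymonomial (e i) (a i)) -> ymonomial (\sum_i e i)%N (mop C a).
Proof.
move=> he.
have /choice [d hd] : forall i, exists d,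
    monomial (@gen k m V ('I_n + 'I_n)%type) d (a i) /\ ydeg d = e i.
  by move=> i; have [d] := he i; exists d.
exists (fun x => \sum_i d i x)%N; first by constructor => i; have [] := hd i.
rewrite /ydeg exchange_big; apply: eq_bigr => i _.
by have [_ <-] := hd i.
Qed.

Lemma mop_span1 (i : 'I_m) (a : 'I_m -> C) x :
  (forall j, j != i -> span (ymonomial 0) (a j)) -> span (ymonomial 1) x ->
  span (ymonomial 1) (mop C [eta a with i |-> x]).
Proof.
move=> ha hx.
have e1 : (\sum_j (j == i : nat))%N = 1%N.
  by rewrite (bigD1 i) //= eqxx big1 // => j /negPf->.
apply: (mop_span (S := fun j => ymonomial (j == i))) => [b hb|j] /=.
  by rewrite -e1; apply: ymonomial_mop.
by case: eqP => // /eqP; apply: ha.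
Qed.

Lemma iota_hom : is_hom iota.
Proof. exact/lift_is_hom/free_in_class. Qed.

Lemma iota_gen i : iota (gen V i) = xvar i.
Proof. exact/lift_gen/free_in_class. Qed.

Lemma iota_span (a : A) : span (ymonomial 0) (iota a).
Proof.
rewrite -[a]nreprK npi_eval (hom_neval _ _ iota_hom).
elim: (nrepr a) => [i||hu|s hs t ht|c t ht|f hf] /=.
- rewrite iota_gen; apply: span_sub; exists (fun z => (z == inl i : nat)).
    exact: mono_gen.
  by rewrite /ydeg big1.
- exact: span0.
- apply: span_sub; exists (fun=> 0%N); first exact: mono_one.
  by rewrite /ydeg big1.
- by rewrite -[X in X + _]scale1r; apply: span_lin.
- by rewrite -[X in span _ X]addr0; apply: span_lin => //; apply: span0.
- apply: (mop_span (S := fun=> ymonomial 0)) => // b hb.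
  by have := ymonomial_mop hb; rewrite big1.
Qed.

(* Homogeneous of degree 1 in the y_i *)
Definition OmegaA_pred : {pred C} := [pred w | `[< span (ymonomial 1) w >]].

Lemma OmegaA_submod : submod_closed OmegaA_pred.
Proof.
split=> [|c x y /asboolP hx /asboolP hy]; apply/asboolP; first exact: span0.
exact: span_lin.
Qed.
HB.instance Definition _ := GRing.isSubmodClosed.Build k C OmegaA_pred OmegaA_submod.

Record OmegaA := MkOmegaA { OmegaA_val :> C; OmegaA_valP : OmegaA_val \in OmegaA_pred }.
HB.instance Definition _ := [isSub for OmegaA_val].
HB.instance Definition _ := [Choice of OmegaA by <:].
HB.instance Definition _ := [SubChoice_isSubLmodule of OmegaA by <:].

Lemma Uop_subproof (i : 'I_m) (b : 'I_m.-1 -> A) (w : OmegaA) :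
  mulop i (iota \o b) (w : C) \in OmegaA_pred.
Proof.
apply/asboolP; rewrite /mulop insertE; apply: mop_span1.
  move=> j; rewrite /insert; case: unliftP => [j' _ _|->]; first exact: iota_span.
  by rewrite eqxx.
exact/asboolP/OmegaA_valP.
Qed.

Definition Uop (i : 'I_m) (b : 'I_m.-1 -> A) (w : OmegaA) : OmegaA :=
  MkOmegaA (Uop_subproof i b w).

Lemma Uop_linear i b : linear (Uop i b).
Proof. by move=> c x y; apply: val_inj; apply: (mulop_linear i (iota \o b) c). Qed.
HB.instance Definition _ i b :=
  GRing.isLinear.Build k OmegaA OmegaA *:%R (Uop i b) (Uop_linear i b).

Definition Uops : set {linear OmegaA -> OmegaA} :=
  [set g | exists i (b : 'I_m.-1 -> A), g = Uop i b].
Definition envalg := opalg Uops.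

Lemma yvar_subproof i : yvar i \in OmegaA_pred.
Proof.
apply/asboolP/span_sub; exists (fun z => (z == inr i : nat)); first exact: mono_gen.
rewrite /ydeg (bigD1 i) //= eqxx big1 // => j ji.
by rewrite (inj_eq inr_inj) (negPf ji).
Qed.
Definition yv i : OmegaA := MkOmegaA (yvar_subproof i).

Lemma Uop_mem i b : Uops (Uop i b). Proof. by exists i, b. Qed.

Lemma ymonomial0_iota d w :
  monomial (@gen k m V ('I_n + 'I_n)%type) d w -> ydeg d = 0%N ->
  exists a : A, w = iota a.
Proof.
elim=> [[i|i]|hu|{}d a _ IH].
- by exists (gen V i); rewrite iota_gen.
- by rewrite /ydeg (bigD1 i) //= eqxx.
- by exists (mone A hu); have [_ _ ->] := iota_hom.
- rewrite /ydeg exchange_big => /eqP; rewrite sum_nat_eq0 => /forallP h.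
  have /choice [b hb] : forall i, exists b, a i = iota b.
    by move=> i; apply: IH; apply/eqP; have := h i.
  exists (mop A b); have [_ -> _] := iota_hom.
  by congr mop; apply/funext.
Qed.

Lemma ymonomial1_coord d w :
  monomial (@gen k m V ('I_n + 'I_n)%type) d w -> ydeg d = 1%N ->
  exists c : 'I_n -> envalg, w = OmegaA_val (\sum_i c i (yv i)).
Proof.
elim=> [[i|i]|hu|{}d a ha IH].
- by rewrite /ydeg big1.
- exists (fun j => if j == i then 1 else 0).
  rewrite (bigD1 i) //= eqxx op1E big1 ?addr0 // => j /negPf->.
  by rewrite op0E.
- by rewrite /ydeg big1.
- rewrite /ydeg exchange_big => /eqP/sum_nat_eq1[i [_ hi h0]].
  have [c hc] := IH i hi.
  have /choice [b hb] : forall j, exists b, a (lift i j) = iota b.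
    move=> j; apply: (ymonomial0_iota (ha _)).
    by apply: h0; rewrite // eq_sym neq_lift.
  exists (fun j => op_gen (Uop_mem i b) * c j).
  rewrite (eq_bigr (fun j => Uop i b (c j (yv j)))) // -linear_sum /= -hc.
  rewrite /mulop -[in LHS](insert_id a i).
  have -> : a \o lift i = iota \o b by apply/funext => j; rewrite /= hb.
  by [].
Qed.

Lemma OmegaA_coord (w : OmegaA) : exists c : 'I_n -> envalg, w = \sum_i c i (yv i).
Proof.
suff H x : span (ymonomial 1) x ->
    exists c : 'I_n -> envalg, x = OmegaA_val (\sum_i c i (yv i)).
  have /asboolP/H [c hc] := OmegaA_valP w.
  by exists c; apply: val_inj.
move: x; apply: span_ind_lin => [|e x y [c ->] [d ->]|x [d]].
- exists (fun=> 0); rewrite big1 //.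
- exists (fun i => e *: c i + d i); rewrite big_split /=.
  by rewrite -scaler_sumr.
- exact: ymonomial1_coord.
Qed.

Definition ysubst (f : 'I_n -> C) : C -> C :=
  lift_hom (fun z : 'I_n + 'I_n => match z with inl i => xvar i | inr i => f i end).

Lemma ysubst_hom f : is_hom (ysubst f).
Proof. exact/lift_is_hom/free_in_class. Qed.

Lemma ysubst_iota f a : ysubst f (iota a) = iota a.
Proof.
rewrite -[a]nreprK npi_eval !(hom_neval _ _ iota_hom) (hom_neval _ _ (ysubst_hom f)).
congr neval; apply/funext => i /=; rewrite iota_gen /ysubst lift_gen //.
exact: free_in_class.
Qed.

Lemma ysubst_env f (c : envalg) (w w' : OmegaA) :
  ysubst f w = w' -> ysubst f (c w) = c w'.
Proof.
have [fl fm _] := ysubst_hom f.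
have /opgenP := op_funP c; move: (op_fun c) => g hg.
elim: hg w w' => {g} [g [i [b ->]]|//|e g h _ IHg _ IHh|g h _ IHg _ IHh] w w' hw.
- rewrite /= /mulop fm; congr (mop C _); apply/funext => j /=; rewrite /insert.
  by case: unliftP => //= j' _; rewrite ysubst_iota.
- rewrite !addrfctE !scalrfctE /=.
  by rewrite fl (IHg _ w') // (IHh _ w').
- by apply: (IHg (h w) (h w')); apply: IHh.
Qed.

Lemma yv_free (c : 'I_n -> envalg) : \sum_i c i (yv i) = 0 -> c = fun=> 0.
Proof.
move=> hc; apply/funext => j; apply: opalg_eq => w.
pose f i := if i == j then (w : C) else 0.
have [fl _ _] := ysubst_hom f.
pose fL : {linear C -> C} := HB.pack (ysubst f) (GRing.isLinear.Build _ _ _ _ _ fl).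
have : fL (OmegaA_val (\sum_i c i (yv i))) = 0 by rewrite hc; apply: (raddf0 fL).
have -> : OmegaA_val (\sum_i c i (yv i)) = \sum_i OmegaA_val (c i (yv i)).
  by elim/big_rec2: _ => // i x y _ <-.
rewrite (raddf_sum fL) (bigD1 j) //= big1 => [|i /negPf ij].
  rewrite addr0 (@ysubst_env f (c j) (yv j) w) => [h|]; first exact: val_inj.
  by rewrite /ysubst lift_gen ?/f ?eqxx //; apply: free_in_class.
rewrite (@ysubst_env f (c i) (yv i) 0) ?linear0 //.
by rewrite /ysubst lift_gen ?/f ?ij //; apply: free_in_class.
Qed.

Lemma OmegaA_free (w : OmegaA) : exists! c : 'I_n -> envalg, w = \sum_i c i (yv i).
Proof.
have [c hc] := OmegaA_coord w; exists c; split=> // d; rewrite hc => hd.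
have /yv_free h : \sum_i (fun i => c i - d i) i (yv i) = 0.
  by rewrite (eq_bigr (fun i => c i (yv i) - d i (yv i))) // sumrB hd subrr.
by apply/funext => i; apply/eqP; rewrite -subr_eq0; apply/eqP; have := congr1 (@^~ i) h.
Qed.

Definition ycoord (w : OmegaA) : 'I_n -> envalg := sval (cid (OmegaA_free w)).

Lemma ycoordE (w : OmegaA) : w = \sum_i ycoord w i (yv i).
Proof. by rewrite /ycoord; case: cid => c []. Qed.

Lemma der_mone (D : Der C) (hu : unitary V) : D (mone C hu) = 0.
Proof.
have m2 := var_unitary hu.
have one1 : mone C hu = mop C (fun=> mone C hu).
  have i : 'I_m by rewrite m2; exact: ord0.
  rewrite -[LHS](mone_id hu i); congr mop.
  by apply/funext => j /=; case: eqP.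
have : D (mone C hu) = D (mone C hu) *+ m.
  rewrite {1}one1 der_mop (eq_bigr (fun=> D (mone C hu))) => [|i _]; last exact: mone_id.
  by rewrite sumr_const card_ord.
have -> (x : C) : x *+ m = x + x by rewrite -mulr2n; congr (x *+ _).
by move=> /eqP; rewrite -subr_eq0 opprD addrA subrr add0r oppr_eq0 => /eqP.
Qed.

Lemma Omega_subproof (b : A) : Omega (iota b) \in OmegaA_pred.
Proof.
apply/asboolP.
rewrite -[b]nreprK npi_eval (hom_neval _ _ iota_hom).
elim: (nrepr b) => [i||hu|s hs t ht|c t ht|f hf] /=.
- rewrite iota_gen /Omega der_ofE; exact/asboolP/yvar_subproof.
- by rewrite linear0; apply: span0.
- by rewrite der_mone; apply: span0.
- by rewrite linearD -[X in X + _]scale1r; apply: span_lin.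
- by rewrite linearZ -[X in span _ X]addr0; apply: span_lin => //; apply: span0.
- rewrite der_mop; elim/big_ind: _ => [|x y hx hy|i _]; first exact: span0.
    by rewrite -[x]scale1r; apply: span_lin.
  by apply: mop_span1 => // j _; rewrite -(hom_neval _ _ iota_hom); apply: iota_span.
Qed.

Definition fox (b : A) : 'I_n -> envalg := ycoord (MkOmegaA (Omega_subproof b)).

Lemma foxE (b : A) : Omega (iota b) = OmegaA_val (\sum_i fox b i (yv i)).
Proof. by rewrite -ycoordE. Qed.

Definition jacobian_of (F : 'I_n -> A) : 'M[envalg]_n := \matrix_(i, j) fox (F i) j.

Definition jacobian (D : LA V n) : 'M[envalg]_n := jacobian_of (fun i => D (gen V i)).

End Fox.

(* Main.v *)
(** For a derivation [u], let [sigma_u] be the homomorphism C -> A fixing the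
    x_i and sending y_i to u(x_i). Then u(b) = sigma_u (Omega b), so the
    chain rule says that the column of u . D is the image under [sigma_u] of the
    column J(D) y. Moreover [sigma_(u . D)] is [sigma_u] after the A^e-linear
    substitution y |-> J(D) y, hence the column of R_D^N u is the image under
    [sigma_u] of J(D)^N y. *)

From mathcomp Require Import all_boot all_algebra.
From mathcomp Require Import boolp.
Require Import Defs.

Set Implicit Arguments.
Unset Strict Implicit.
Unset Printing Implicit Defensive.
Import GRing.Theory.
Local Open Scope ring_scope.

Section RightMultiplication.
Context (k : fieldType) (m : nat) (V : variety k m) (n : nat).
Let A := free V 'I_n.
Let C := free V ('I_n + 'I_n)%type.

Lemma is_hom_comp (u : bool) (B1 B2 B3 : malgebra k m u)
    (f : B1 -> B2) (g : B2 -> B3) :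
  is_hom f -> is_hom g -> is_hom (g \o f).
Proof.
case=> fl fm f1 [gl gm g1]; split=> [c x y|a|hu] /=.
- by rewrite fl gl.
- by rewrite fm gm.
- by rewrite f1 g1.
Qed.

Lemma is_hom_id (u : bool) (B : malgebra k m u) : is_hom (@idfun B).
Proof. by []. Qed.

Lemma is_hom0 (u : bool) (B1 B2 : malgebra k m u) (f : B1 -> B2) :
  is_hom f -> f 0 = 0.
Proof. by case=> fl _ _; have := fl (-1) 0 0; rewrite !scaleN1r !addNr. Qed.

Lemma is_hom_sum (u : bool) (B1 B2 : malgebra k m u) (f : B1 -> B2)
    I (r : seq I) (P : pred I) (F : I -> B1) :
  is_hom f -> f (\sum_(i <- r | P i) F i) = \sum_(i <- r | P i) f (F i).
Proof.
move=> fh; have [fl _ _] := fh; apply: big_morph; last exact: is_hom0.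
by move=> x y; rewrite -[x]scale1r fl !scale1r.
Qed.

Lemma OmegaA_val_sum I (r : seq I) (P : pred I) (w : I -> OmegaA V n) :
  OmegaA_val (\sum_(i <- r | P i) w i) = \sum_(i <- r | P i) OmegaA_val (w i).
Proof. by elim/big_rec2: _ => // i x y _ <-. Qed.

(** This is the homomorphism [sigma_u]. *)
Definition yeval (u : Der A) : C -> A :=
  lift_hom (fun z => match z with inl i => gen V i | inr i => u (gen V i) end).

Lemma yeval_hom u : is_hom (yeval u).
Proof. exact/lift_is_hom/free_in_class. Qed.

Lemma yeval_xvar u i : yeval u (xvar V i) = gen V i.
Proof. exact/lift_gen/free_in_class. Qed.

Lemma yeval_yvar u i : yeval u (yvar V i) = u (gen V i).
Proof. exact/lift_gen/free_in_class. Qed.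

Lemma yeval_iota u (a : A) : yeval u (iota a) = a.
Proof.
have h := free_hom_eq (is_hom_comp (iota_hom V n) (yeval_hom u)) (is_hom_id _).
by apply: h => i /=; rewrite iota_gen yeval_xvar.
Qed.

(** [Omega] satisfies the Leibniz rule on C, and [yeval u] undoes [iota], so the rule carries over
    to A. *)
Lemma yeval_Omega_derivation u :
  (fun b : A => yeval u (Omega V n (iota b))) \in derivation (A := A).
Proof.
have [il im _] := iota_hom V n; have [yl ym _] := yeval_hom u.
apply/derivationP; split=> [c x y|a]; first by rewrite il linearP yl.
rewrite im der_mop (is_hom_sum _ _ _ (yeval_hom u)); apply: eq_bigr => i _.
rewrite ym; congr (mop A _); apply/funext => j /=.
by case: eqP => // _; rewrite yeval_iota.
Qed.

(** Derivations of A agreeing on the generators coincide; here both send x_i to u(x_i), because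
    [Omega] sends x_i to y_i. *)
Lemma yeval_Omega u (b : A) : yeval u (Omega V n (iota b)) = u b.
Proof.
suff e : MkDer (yeval_Omega_derivation u) = u by rewrite -[in RHS]e.
by apply: der_ext => i /=; rewrite iota_gen /Omega der_ofE yeval_yvar.
Qed.

(** Two homomorphisms need only be compared on generators: on y_i the right one gives u(D(x_i)) by
    [yeval_Omega], which is the value of u . D at x_i. *)
Lemma yeval_dmul u D (w : C) :
  yeval (dmul u D) w = yeval u (ysubst (fun i => Omega V n (iota (D (gen V i)))) w).
Proof.
have h := free_hom_eq (yeval_hom (dmul u D)) (is_hom_comp (ysubst_hom _) (yeval_hom u)).
apply: h => -[] i /=; rewrite /ysubst lift_gen; try exact: free_in_class.
  by rewrite !yeval_xvar.
by rewrite yeval_yvar yeval_Omega dmulE.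
Qed.

(** The i-th entry of the column M y, the entries of M acting as operators on Omega_A. *)
Definition mxy (M : 'M[envalg V n]_n) (i : 'I_n) : OmegaA V n :=
  \sum_j M i j (yv V j).

(** Substituting for the y_j fixes the x_i, so it commutes with the operators of A^e; hence N enters
    to the right of M. *)
Lemma ysubst_mxy (M N : 'M[envalg V n]_n) i :
  ysubst (fun j => mxy N j) (mxy M i) = mxy (M *m N) i.
Proof.
rewrite /mxy OmegaA_val_sum (is_hom_sum _ _ _ (ysubst_hom _)).
transitivity (OmegaA_val (\sum_j M i j (mxy N j))).
  rewrite OmegaA_val_sum; apply: eq_bigr => j _; apply: ysubst_env.
  by rewrite /ysubst lift_gen //; apply: free_in_class.
congr OmegaA_val; under eq_bigr => j _ do rewrite linear_sum.
rewrite exchange_big; apply: eq_bigr => l _.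
by rewrite mxE op_sumE.
Qed.

Lemma Rmul_expE (D u : LA V n) N i :
  ((Rmul D) ^+ N) u (gen V i) = yeval u (mxy ((jacobian D) ^+ N) i).
Proof.
elim: N u => [|N IH] u.
  rewrite !expr0 op1E /mxy (bigD1 i) //= big1 => [|j ji].
    by rewrite addr0 mxE eqxx op1E yeval_yvar.
  by rewrite mxE eq_sym (negPf ji) op0E.
(* Splitting off the innermost R_D replaces u by u . D, which is why the induction keeps u
   general. *)
rewrite !exprSr opME IH /= yeval_dmul -ysubst_mxy.
congr (yeval u (ysubst _ _)); apply/funext => j.
(* Row j of J(D) y is [Omega] of D(x_j), by the definition of Fox derivatives. *)
by rewrite foxE /mxy; congr OmegaA_val; apply: eq_bigr => l _; rewrite mxE.
Qed.

End RightMultiplication.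

Theorem corollary1 (k : fieldType) (m : nat) (hm : (2 <= m)%N) (V : variety k m)
    (n : nat) (D : LA V n) :
  nilpotent (jacobian D) -> nilpotent (Rmul D).
Proof.
(* The same exponent serves, since a derivation is determined by its column. *)
move=> [N JN0]; exists N; apply: opalg_eq => u.
apply: der_ext => i; rewrite Rmul_expE JN0 /mxy big1 => [|j _].
  exact/is_hom0/yeval_hom.
by rewrite mxE op0E.
Qed.
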